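(* Let $X$ be any object of an elementary topos $\mathcal E$. The join operator $\bigvee\colon P^2X\to PX$ satisfies, for every generalized element $\langle x,s\rangle\colon W\to X\times P^2X$, $$W\Vdash x\in_X\bigvee s\quad\text{if, and only if,}\quad W\Vdash\exists y\,\big((x\in_X y)\wedge(y\in_{PX}s)\big),$$ where $y$ is a variable of type $PX$.
   Context: Topos notation. $\top\colon 1\to\Omega$ is the subobject classifier, $\top_W\colon W\to 1\to\Omega$. $PX$ is the power object of $X$ with membership morphism $\in_X\colon X\times PX\to\Omega$; each $g\colon X\times Y\to\Omega$ has a unique transpose $\hat g\colon Y\to PX$ with $\in_X\circ(1\times\hat g)=g$. For $\langle x,s\rangle\colon W\to X\times PX$ write $x\in_X s$ for $\in_X\circ\langle x,s\rangle\colon W\to\Omega$. $PX$ is an internal Heyting algebra, with order the equalizer of meet and first projection. Join operator. $\downarrow\colon PX\to P^2X$ is the transpose of the classifying morphism of the order on $PX$, so $(u\in_{PX}\downarrow v)=(u\le v)$; the join operator $\bigvee\colon P^2X\to PX$ is its internal left adjoint, constructed explicitly as follows. $\bigvee_\Omega\colon P\Omega\to\Omega$ is $t\mapsto(\top\in_\Omega t)$. Let $\langle c,d\rangle\colon U_{PX}\rightarrowtail PX\times P^2X$ be the subobject classified by $\in_{PX}$, let $\phi\colon\Omega\times X\times P^2X\to\Omega$ classify the image of $X\times U_{PX}\to\Omega\times X\times P^2X$, $(x,u)\mapsto(x\in_X c(u),x,d(u))$, and let $\hat\phi\colon X\times P^2X\to P\Omega$ be its transpose. Then $\bigvee\colon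 P^2X\to PX$ is the unique morphism with $\in_X\circ(1\times\bigvee)=\bigvee_\Omega\circ\hat\phi$. Forcing. For $\phi\colon Z\to\Omega$ and $a\colon W\to Z$, $W\Vdash\phi(a)$ means $\phi\circ a=\top_W$. For $\psi\colon Z\times Y\to\Omega$, $\exists y\,\psi\colon Z\to\Omega$ is the transpose $Z\to PY$ of $\psi$ followed by the direct image $\exists_Y\colon PY\to P1\cong\Omega$ along $Y\to 1$. Equivalently, $W\Vdash\exists y\,\psi(a,y)$ iff there are an epimorphism $p\colon V\twoheadrightarrow W$ and $b\colon V\to Y$ with $V\Vdash\psi(ap,b)$. *)

(* Defs.v *)
From mathcomp Require Import ssreflect ssrfun.

Set Implicit Arguments.
Unset Strict Implicit.
Unset Printing Implicit Defensive.

Declare Scope topos_scope.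
Delimit Scope topos_scope with topos.
Local Open Scope topos_scope.

Record category := Category {
  ob :> Type;
  hom : ob -> ob -> Type;
  idm : forall A, hom A A;
  comp : forall A B C, hom B C -> hom A B -> hom A C;
  comp_idl : forall A B (f : hom A B), comp (idm B) f = f;
  comp_idr : forall A B (f : hom A B), comp f (idm A) = f;
  comp_assoc : forall A B C D (h : hom C D) (g : hom B C) (f : hom A B),
    comp h (comp g f) = comp (comp h g) f
}.

Arguments hom {c} A B.
Arguments idm {c} A.
Arguments comp {c A B C} g f.

Notation "g ∘ f" := (comp g f) (at level 40, left associativity) : topos_scope.

Definition mono (C : category) (A B : C) (m : hom A B) : Prop :=
  forall W (u v : hom W A), m ∘ u = m ∘ v -> u = v.

Definition is_equalizer (C : category) (E A B : C)
    (e : hom E A) (f g : hom A B) : Prop :=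
  f ∘ e = g ∘ e /\
  forall W (a : hom W A), f ∘ a = g ∘ a -> exists! u : hom W E, e ∘ u = a.

(** The square [f ∘ p = g ∘ q] is cartesian. *)
Definition is_pullback (C : category) (P A B D : C)
    (p : hom P A) (q : hom P B) (f : hom A D) (g : hom B D) : Prop :=
  f ∘ p = g ∘ q /\
  forall W (a : hom W A) (b : hom W B), f ∘ a = g ∘ b ->
    exists! u : hom W P, p ∘ u = a /\ q ∘ u = b.

(** Finite limits are given by a terminal object, binary products and
    equalizers; exponentials are not required, since they can be constructed
    from power objects. *)
Record topos := Topos {
  topos_cat :> category;

  one : topos_cat;
  bang : forall A : topos_cat, hom A one;
  bang_unique : forall (A : topos_cat) (u : hom A one), u = bang A;

  times : topos_cat -> topos_cat -> topos_cat;
  pr1 : forall A B, hom (times A B) A;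
  pr2 : forall A B, hom (times A B) B;
  pairing : forall W A B, hom W A -> hom W B -> hom W (times A B);
  pr1_pair : forall W A B (a : hom W A) (b : hom W B), pr1 A B ∘ pairing a b = a;
  pr2_pair : forall W A B (a : hom W A) (b : hom W B), pr2 A B ∘ pairing a b = b;
  pair_unique : forall W A B (u : hom W (times A B)),
    u = pairing (pr1 A B ∘ u) (pr2 A B ∘ u);

  eqz : forall A B : topos_cat, hom A B -> hom A B -> topos_cat;
  eqz_arr : forall (A B : topos_cat) (f g : hom A B), hom (eqz f g) A;
  eqz_arrP : forall (A B : topos_cat) (f g : hom A B),
    is_equalizer (eqz_arr f g) f g;

  Omega : topos_cat;
  truth : hom one Omega;
  chi : forall (S A : topos_cat) (m : hom S A), mono m -> hom A Omega;
  chiP : forall (S A : topos_cat) (m : hom S A) (hm : mono m),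
    is_pullback m (bang S) (chi hm) truth;
  chi_unique : forall (S A : topos_cat) (m : hom S A) (hm : mono m)
      (phi : hom A Omega),
    is_pullback m (bang S) phi truth -> phi = chi hm;

  Pow : topos_cat -> topos_cat;
  mem : forall X : topos_cat, hom (times X (Pow X)) Omega;
  transpose : forall X Y : topos_cat, hom (times X Y) Omega -> hom Y (Pow X);
  mem_transpose : forall (X Y : topos_cat) (g : hom (times X Y) Omega),
    mem X ∘ pairing (pr1 X Y) (transpose g ∘ pr2 X Y) = g;
  transpose_unique : forall (X Y : topos_cat) (g : hom (times X Y) Omega)
      (h : hom Y (Pow X)),
    mem X ∘ pairing (pr1 X Y) (h ∘ pr2 X Y) = g -> h = transpose g
}.

Arguments one {t}.
Arguments bang {t} A.
Arguments times {t} A B.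
Arguments pr1 {t A B}.
Arguments pr2 {t A B}.
Arguments pairing {t W A B} a b.
Arguments eqz {t A B} f g.
Arguments eqz_arr {t A B} f g.
Arguments Omega {t}.
Arguments truth {t}.
Arguments chi {t S A m} hm.
Arguments Pow {t} X.
Arguments mem {t} X.
Arguments transpose {t X Y} g.

Notation "⟨ a , b ⟩" := (pairing a b) (at level 0) : topos_scope.

Section ToposTheory.
Variable E : topos.
Implicit Types (W X Y Z A B S : E).

Definition top W : hom W Omega := truth ∘ bang W.

(** [x ∈ s] for a generalized element [⟨x, s⟩ : W -> X × PX]. *)
Definition inn W X (x : hom W X) (s : hom W (Pow X)) : hom W Omega :=
  mem X ∘ ⟨x, s⟩.

Lemma pairE W X Y (u v : hom W (times X Y)) :
  pr1 ∘ u = pr1 ∘ v -> pr2 ∘ u = pr2 ∘ v -> u = v.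
Proof. by move=> h1 h2; rewrite (pair_unique u) (pair_unique v) h1 h2. Qed.

Lemma pair_comp V W X Y (a : hom W X) (b : hom W Y) (f : hom V W) :
  ⟨a, b⟩ ∘ f = ⟨a ∘ f, b ∘ f⟩.
Proof. by apply: pairE; rewrite comp_assoc !(pr1_pair, pr2_pair). Qed.

Lemma bangE W (u v : hom W one) : u = v.
Proof. by rewrite (bang_unique u) (bang_unique v). Qed.

Lemma top_comp V W (f : hom V W) : top W ∘ f = top V.
Proof. by rewrite /top -comp_assoc (bangE (bang W ∘ f) (bang V)). Qed.

Lemma inn_comp V W X (x : hom W X) (s : hom W (Pow X)) (f : hom V W) :
  inn x s ∘ f = inn (x ∘ f) (s ∘ f).
Proof. by rewrite /inn -comp_assoc pair_comp. Qed.

Lemma inn_transpose W X Y (g : hom (times X Y) Omega) (x : hom W X)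
    (y : hom W Y) :
  inn x (transpose g ∘ y) = g ∘ ⟨x, y⟩.
Proof.
rewrite -{2}(mem_transpose g) -comp_assoc pair_comp -comp_assoc.
by rewrite pr1_pair pr2_pair.
Qed.

Lemma pow_ext Y X (h k : hom Y (Pow X)) :
  inn (@pr1 E X Y) (h ∘ pr2) = inn pr1 (k ∘ pr2) -> h = k.
Proof.
by move=> hk; rewrite (transpose_unique hk); symmetry; apply: transpose_unique.
Qed.

Lemma eqz_mono A B (f g : hom A B) : mono (eqz_arr f g).
Proof.
move=> W u v uv; have [efg univ] := eqz_arrP f g.
have [|w [_ w_uniq]] := univ W (eqz_arr f g ∘ u).
  by rewrite !comp_assoc efg.
by rewrite -(w_uniq u erefl) -(w_uniq v (esym uv)).
Qed.

Lemma pair_top_mono : mono ⟨@truth E, truth⟩.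
Proof. by move=> W u v _; apply: bangE. Qed.

Definition meet : hom (times Omega Omega) Omega := chi pair_top_mono.

Definition andO W (p q : hom W Omega) : hom W Omega := meet ∘ ⟨p, q⟩.

(** The subobject of [Z] classified by [phi]. *)
Definition sub Z (phi : hom Z Omega) : E := eqz phi (top Z).

Definition sub_arr Z (phi : hom Z Omega) : hom (sub phi) Z :=
  eqz_arr phi (top Z).

Lemma sub_mono Z (phi : hom Z Omega) : mono (sub_arr phi).
Proof. exact: eqz_mono. Qed.

Lemma chi_sub Z (phi : hom Z Omega) : chi (@sub_mono Z phi) = phi.
Proof.
symmetry; apply: chi_unique.
have [e univ] := eqz_arrP phi (top Z).
split; first by rewrite e top_comp.
move=> W a b ab; have [|u [ua u_uniq]] := univ W a.
  by rewrite ab top_comp /top (bangE b (bang W)).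
exists u; split; first by split=> //; apply: bangE.
by move=> v [va _]; apply: u_uniq.
Qed.

(** The image of [f]: the least subobject of [B] through which [f] factors. *)
Record image_of A B (f : hom A B) := ImageOf {
  im_ob : E;
  im_arr : hom im_ob B;
  im_mono : mono im_arr;
  im_factor : exists e : hom A im_ob, im_arr ∘ e = f;
  im_least : forall S (m : hom S B), mono m ->
    (exists e : hom A S, m ∘ e = f) ->
    exists u : hom im_ob S, m ∘ u = im_arr
}.

Arguments im_mono {A B f} i.

(** Existence of images. [imK f] is [{S : PB | f a ∈ S for all a : A}], and the
    image of [f] is [{b : B | b ∈ S for all S in imK f}]. *)
Section Image.
Variables (A B : E) (f : hom A B).

Let preim : hom (Pow B) (Pow A) := transpose (inn (f ∘ pr1) pr2).
Let full Y X : hom Y (Pow X) := transpose (top (times X Y)).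

Definition imK : E := eqz preim (full (Pow B) A).
Definition imK_arr : hom imK (Pow B) := eqz_arr preim (full (Pow B) A).

Let supersets : hom B (Pow imK) := transpose (inn pr2 (imK_arr ∘ pr1)).

Definition imI : E := eqz supersets (full B imK).
Definition imI_arr : hom imI B := eqz_arr supersets (full B imK).

Lemma inn_preim W (a : hom W A) (s : hom W (Pow B)) :
  inn a (preim ∘ s) = inn (f ∘ a) s.
Proof. by rewrite inn_transpose inn_comp -comp_assoc pr1_pair pr2_pair. Qed.

Lemma inn_full W X Y (x : hom W X) (y : hom W Y) :
  inn x (full Y X ∘ y) = top W.
Proof. by rewrite inn_transpose top_comp. Qed.

Lemma inn_supersets W (k : hom W imK) (b : hom W B) :
  inn k (supersets ∘ b) = inn b (imK_arr ∘ k).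
Proof. by rewrite inn_transpose inn_comp -comp_assoc pr1_pair pr2_pair. Qed.

Lemma imI_factor : exists e : hom A imI, imI_arr ∘ e = f.
Proof.
have [_ univ] := eqz_arrP supersets (full B imK).
have [|e [ef _]] := univ A f; last by exists e.
apply: pow_ext; rewrite -!comp_assoc inn_full inn_supersets -inn_preim.
by rewrite comp_assoc (proj1 (eqz_arrP preim (full (Pow B) A)))
           -comp_assoc inn_full.
Qed.

Lemma imI_least S (m : hom S B) : mono m ->
  (exists e : hom A S, m ∘ e = f) -> exists u : hom imI S, m ∘ u = imI_arr.
Proof.
move=> hm [e mef].
have [chi_m univ_m] := chiP hm.
pose n : hom one (Pow B) := transpose (chi hm ∘ pr1).
have inn_n W (b : hom W B) (w : hom W one) : inn b (n ∘ w) = chi hm ∘ b.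
  by rewrite inn_transpose -comp_assoc pr1_pair.
have [|k [kn _]] := proj2 (eqz_arrP preim (full (Pow B) A)) one n.
  apply: pow_ext; rewrite -!comp_assoc inn_full inn_preim inn_n.
  by rewrite -mef -comp_assoc comp_assoc chi_m -[_ ∘ bang S]/(top S) top_comp.
have chiI : chi hm ∘ imI_arr = truth ∘ bang imI.
  rewrite -(inn_n _ imI_arr (bang imI)) -kn -comp_assoc -inn_supersets.
  by rewrite (proj1 (eqz_arrP supersets (full B imK))) inn_full.
by have [u [[mu _] _]] := univ_m _ _ _ chiI; exists u.
Qed.

Definition image : image_of f :=
  ImageOf (@eqz_mono _ _ supersets (full B imK)) imI_factor imI_least.

End Image.

Definition chi_image A B (f : hom A B) : hom B Omega := chi (im_mono (image f)).

(** [⟨el, elset⟩ : U X -> X × PX] is the subobject classified by membership. *)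
Definition U X : E := sub (mem X).
Definition el X : hom (U X) X := pr1 ∘ sub_arr (mem X).
Definition elset X : hom (U X) (Pow X) := pr2 ∘ sub_arr (mem X).

Definition bigvee_Omega : hom (Pow Omega) (@Omega E) := inn (top (Pow Omega)) (idm _).

Definition join_phi X : hom (times Omega (times X (Pow (Pow X)))) Omega :=
  chi_image (A := times X (U (Pow X)))
    ⟨inn pr1 (el (Pow X) ∘ pr2), ⟨pr1, elset (Pow X) ∘ pr2⟩⟩.

Definition join X : hom (Pow (Pow X)) (Pow X) :=
  transpose (bigvee_Omega ∘ transpose (join_phi X)).

(** [∃_f : PA -> PB], sending [s] to [{f a | a ∈ s}]: it names the family of
    subobjects of [B] given by the image of [U A -> B × PA]. *)
Definition direct_image A B (f : hom A B) : hom (Pow A) (Pow B) :=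
  transpose (chi_image ⟨f ∘ el A, elset A⟩).

(** The isomorphism [P1 ≅ Ω]. *)
Definition Pow_one : hom (Pow one) (@Omega E) := inn (bang (Pow one)) (idm _).

(** [∃ y, psi]; [psi] is swapped because [transpose] abstracts the first
    factor, whereas the bound variable is the second one. *)
Definition exO Z Y (psi : hom (times Z Y) Omega) : hom Z Omega :=
  Pow_one ∘ direct_image (bang Y) ∘ transpose (psi ∘ ⟨pr2, pr1⟩).

Definition forces W Z (phi : hom Z Omega) (a : hom W Z) : Prop :=
  phi ∘ a = top W.

End ToposTheory.

Arguments forces {E} W {Z} phi a.

(* Main.v *)
(** Both sides of the equivalence say that a generalized element of some object
    [B] belongs to the image of a morphism [f : A -> B].  Although an element
    [b] of an image need not lift to [A], lifts of [b] may be assumed to exist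
    when proving [omega : W -> Omega]: the elements [b'] such that
    [b' = b w => omega w] for all [w : W] form a subobject of [B] through which
    [f], hence its image, factors.  Image membership of [b] therefore implies image membership
    of [b'] as soon as every lift of [b] along some [r : V -> W] yields a lift
    of [b'] along [r], and in both directions of the theorem this amounts to
    repackaging an element [y] with [x ∈ y] and [y ∈ s]. *)
From mathcomp Require Import ssreflect ssrfun.
Require Import Defs.
Local Open Scope topos_scope.

Set Implicit Arguments.
Unset Strict Implicit.
Unset Printing Implicit Defensive.

Section ImageMembership.
Variable E : topos.
Implicit Types (A B V W X Y Z : E).

Lemma pair_inj W X Y (a a' : hom W X) (b b' : hom W Y) :
  ⟨a, b⟩ = ⟨a', b'⟩ -> a = a' /\ b = b'.
Proof.
move=> ab; rewrite -(pr1_pair a b) -{2}(pr2_pair a b) ab.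
by rewrite pr1_pair pr2_pair.
Qed.

Lemma chi_top W A S (m : hom S A) (hm : mono m) (a : hom W A) :
  chi hm ∘ a = top W <-> exists e : hom W S, m ∘ e = a.
Proof.
have [chi_m univ_m] := chiP hm; split=> [/univ_m [e [[me _] _]]|[e <-]].
  by exists e.
by rewrite comp_assoc chi_m -[_ ∘ bang S]/(top S) top_comp.
Qed.

(** The hypothesis makes [sub_arr q] a pullback of [truth] along [p] as well, and classifying
    morphisms are unique. *)
Lemma top_ext Z (p q : hom Z Omega) :
  (forall V (r : hom V Z), p ∘ r = top V <-> q ∘ r = top V) -> p = q.
Proof.
move=> pq; rewrite -(chi_sub q); apply: chi_unique.
have [q_sub univ] := eqz_arrP q (top Z).
split; first by apply/pq; rewrite q_sub top_comp.
move=> W a b; rewrite (bangE b (bang W)) => /pq qa.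
have [|u [ua u_uniq]] := univ W a; first by rewrite qa top_comp.
exists u; split; first by split=> //; apply: bangE.
by move=> v [va _]; apply: u_uniq.
Qed.

Lemma diag_mono A : mono ⟨idm A, idm A⟩.
Proof.
move=> W u v /(f_equal (comp pr1)).
by rewrite !comp_assoc !pr1_pair !comp_idl.
Qed.

Definition eqO W A (a b : hom W A) : hom W Omega :=
  chi (@diag_mono A) ∘ ⟨a, b⟩.

Lemma eqO_top W A (a b : hom W A) : eqO a b = top W <-> a = b.
Proof.
split=> [/chi_top [e]|->].
  by rewrite pair_comp comp_idl => /pair_inj [<- <-].
by apply/chi_top; exists b; rewrite pair_comp comp_idl.
Qed.

Lemma eqO_comp V W A (a b : hom W A) (r : hom V W) :
  eqO a b ∘ r = eqO (a ∘ r) (b ∘ r).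
Proof. by rewrite /eqO -comp_assoc pair_comp. Qed.

Lemma andO_top W (p q : hom W Omega) :
  andO p q = top W <-> p = top W /\ q = top W.
Proof.
split=> [/chi_top [e]|[-> ->]].
  by rewrite pair_comp (bangE e (bang W)) => /pair_inj [<- <-].
by apply/chi_top; exists (bang W); rewrite pair_comp.
Qed.

Lemma andO_comp V W (p q : hom W Omega) (r : hom V W) :
  andO p q ∘ r = andO (p ∘ r) (q ∘ r).
Proof. by rewrite /andO -comp_assoc pair_comp. Qed.

Definition impO W (p q : hom W Omega) : hom W Omega := eqO (andO p q) p.

Lemma impO_comp V W (p q : hom W Omega) (r : hom V W) :
  impO p q ∘ r = impO (p ∘ r) (q ∘ r).
Proof. by rewrite /impO eqO_comp andO_comp. Qed.

(** Kripke-Joyal clause for implication: [impO] is the internal equality of [p ∧ q] and [p], which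
    [top_ext] tests on generalized elements. *)
Lemma impO_top W (p q : hom W Omega) :
  impO p q = top W <->
  forall V (r : hom V W), p ∘ r = top V -> q ∘ r = top V.
Proof.
split=> [/eqO_top pq V r|pq].
  by rewrite -pq andO_comp => /andO_top [].
apply/eqO_top/top_ext => V r; rewrite andO_comp.
by split=> [/andO_top []|pr] //; apply/andO_top; split=> //; apply: pq.
Qed.

Lemma chi_image_comp A B (f : hom A B) V (a : hom V A) :
  chi_image f ∘ (f ∘ a) = top V.
Proof.
have [e fe] := im_factor (image f); apply/chi_top; exists (e ∘ a).
by rewrite comp_assoc fe.
Qed.

Lemma chi_image_elim A B (f : hom A B) W (b : hom W B) (omega : hom W Omega) :
  chi_image f ∘ b = top W ->
  (forall V (r : hom V W) (a : hom V A), f ∘ a = b ∘ r -> omega ∘ r = top V) ->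
  omega = top W.
Proof.
move=> /chi_top [i bi] lift.
pose phi : hom (times W B) Omega := impO (eqO (b ∘ pr1) pr2) (omega ∘ pr1).
have phi_pair V (w : hom V W) (b' : hom V B) :
    phi ∘ ⟨w, b'⟩ = impO (eqO (b ∘ w) b') (omega ∘ w).
  by rewrite impO_comp eqO_comp -!comp_assoc !pr1_pair pr2_pair.
(* Universal quantification over [W]: an element [b'] equalizes [transpose phi] and [full] exactly
   when [phi] holds at [⟨w, b'⟩] for every [w]. *)
pose full := transpose (top (times W B)).
have [eq_phi univ] := eqz_arrP (transpose phi) full.
have [g [fg _]] : exists! g, eqz_arr (transpose phi) full ∘ g = f.
  apply: univ; apply: pow_ext; rewrite -!comp_assoc !inn_transpose top_comp.
  rewrite phi_pair; apply/impO_top => V r.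
  rewrite eqO_comp -!comp_assoc => /eqO_top bf.
  by apply: (lift _ _ (pr2 ∘ r)); rewrite bf.
have [u iu] := im_least (image f) (@eqz_mono _ _ _ (transpose phi) full)
                        (ex_intro _ g fg).
(* Being in the image, [b] lies in this subobject; at the generic element [w = idm W] the premise of
   [phi] becomes [b = b]. *)
have: inn (idm W) (transpose phi ∘ b) = top W.
  by rewrite -bi -iu !comp_assoc eq_phi -!comp_assoc inn_transpose top_comp.
rewrite inn_transpose phi_pair => /impO_top /(_ W (idm W)).
by rewrite !comp_idr; apply; apply/eqO_top.
Qed.

Lemma chi_image_transfer A B A' B' (f : hom A B) (f' : hom A' B')
    W (b : hom W B) (b' : hom W B') :
  (forall V (r : hom V W) (a : hom V A), f ∘ a = b ∘ r ->
     exists a' : hom V A', f' ∘ a' = b' ∘ r) ->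
  chi_image f ∘ b = top W -> chi_image f' ∘ b' = top W.
Proof.
move=> lift /chi_image_elim; apply=> V r a /lift [a' fa'].
by rewrite -comp_assoc -fa' chi_image_comp.
Qed.

Lemma inn_U W X (u : hom W (U X)) : inn (el X ∘ u) (elset X ∘ u) = top W.
Proof.
rewrite -inn_comp /inn -pair_unique (proj1 (eqz_arrP (mem X) (top _))).
by rewrite !top_comp.
Qed.

Lemma U_intro W X (x : hom W X) (s : hom W (Pow X)) :
  inn x s = top W ->
  exists u : hom W (U X), el X ∘ u = x /\ elset X ∘ u = s.
Proof.
move=> xs; have [_ univ] := eqz_arrP (mem X) (top _).
have [|u [xsu _]] := univ W ⟨x, s⟩; first by
  rewrite -[LHS]/(inn x s) xs top_comp.
by exists u; rewrite -!comp_assoc xsu pr1_pair pr2_pair.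
Qed.

(** [bigvee_Omega] is membership of truth, which puts [top W] in the [Omega] coordinate. *)
Lemma inn_join W X (x : hom W X) (s : hom W (Pow (Pow X))) :
  inn x (join X ∘ s) = join_phi X ∘ ⟨top W, ⟨x, s⟩⟩.
Proof.
rewrite inn_transpose -comp_assoc /bigvee_Omega inn_comp comp_idl top_comp.
by rewrite inn_transpose.
Qed.

(** [Pow_one] tests membership of the unique element of [one], so existence becomes membership in an
    image over [one]. *)
Lemma exO_comp W Y Z (psi : hom (times Z Y) Omega) (z : hom W Z) :
  exO psi ∘ z =
  chi_image ⟨bang Y ∘ el Y, elset Y⟩ ∘
    ⟨bang W, transpose (psi ∘ ⟨pr2, pr1⟩) ∘ z⟩.
Proof.
rewrite /exO -2!(comp_assoc (Pow_one E)) /Pow_one inn_comp comp_idl -comp_assoc.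
rewrite inn_transpose.
by rewrite (bangE (_ ∘ _) (bang W)).
Qed.

End ImageMembership.

Theorem proposition3p10 (E : topos) (X W : E)
    (x : hom W X) (s : hom W (Pow (Pow X))) :
  forces W (inn pr1 (join X ∘ pr2)) ⟨x, s⟩ <->
  forces W
    (exO (andO (inn (pr1 ∘ pr1 : hom (times (times X (Pow (Pow X))) (Pow X)) X)
                   pr2)
              (inn pr2 (pr2 ∘ pr1))))
    ⟨x, s⟩.
Proof.
rewrite /forces inn_comp -comp_assoc pr1_pair pr2_pair inn_join exO_comp.
(* [t] is the set of all [y] with [x ∈ y] and [y ∈ s]; only [inn_t] is used of it below. *)
set psi := andO _ _; set t := transpose _ ∘ _.
have inn_t V (r : hom V W) (y : hom V (Pow X)) :
    inn y (t ∘ r) = top V <->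
    inn (x ∘ r) y = top V /\ inn y (s ∘ r) = top V.
  rewrite -comp_assoc inn_transpose -comp_assoc pair_comp pr1_pair pr2_pair.
  rewrite andO_comp !inn_comp -!comp_assoc !pr1_pair !pr2_pair pair_comp.
  by rewrite pr1_pair pr2_pair; apply: andO_top.
move: t inn_t => t inn_t; split; apply: chi_image_transfer => V r a.
  (* A lift [a] carries a pair [y ∈ s], and its [Omega] coordinate being true says [x ∈ y]; hence
     [y ∈ t]. *)
  rewrite !pair_comp top_comp inn_comp -(comp_assoc (el _)).
  rewrite -(comp_assoc (elset _)).
  move=> /pair_inj [xy /pair_inj [xr sr]].
  have [|u [_ tu]] := @U_intro _ _ _ (el (Pow X) ∘ (pr2 ∘ a)) (t ∘ r).
    by apply/inn_t; rewrite -xr -sr inn_U.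
  by exists u; rewrite !pair_comp tu; congr ⟨_, _⟩; apply: bangE.
(* Conversely, a lift is some [y ∈ t]; the pair [y ∈ s] gives [u], and [x ∈ y] makes the [Omega]
   coordinate true. *)
rewrite !pair_comp => /pair_inj [_ ta].
have /inn_t [xy ys] : inn (el (Pow X) ∘ a) (t ∘ r) = top V.
  by rewrite -ta; apply: inn_U.
have [u [yu su]] := U_intro ys; exists ⟨x ∘ r, u⟩.
rewrite !pair_comp top_comp inn_comp -(comp_assoc (el _)).
rewrite -(comp_assoc (elset _)).
by rewrite pr1_pair pr2_pair yu su xy.
Qed.
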